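(* For every Noetherian space $X$, $1 + ||X|| \leq ||\mathcal{H}_{0\mathsf{V}} X|| \leq \omega^{||X||}$.
   Context: A topological space is Noetherian if every open subset is compact (every open cover has a finite subcover; no separation is required). For a well-founded poset $P$ and $x \in P$, $\mathrm{rk}_P(x) = \sup_{x' < x} (\mathrm{rk}_P(x')+1)$ and the ordinal rank of $P$ is $|P| = \sup_{x \in P} (\mathrm{rk}_P(x)+1)$, where $\sup\emptyset = 0$. $\mathcal{H}_0 X$ is the poset of all closed subsets of $X$ (including $\emptyset$), ordered by inclusion; it is well-founded when $X$ is Noetherian. The stature of a Noetherian space $X$ is $||X|| = |\mathcal{H}_0 X| - 1$, equivalently $||X|| = \mathrm{rk}_{\mathcal{H}_0 X}(X)$. The lifted Hoare powerspace $\mathcal{H}_{0\mathsf{V}} X$ is the set of all closed subsets of $X$ (including $\emptyset$) with the lower Vietoris topology, which has as subbase the sets $\Diamond U = \{F \text{ closed in } X \mid F \cap U \neq \emptyset\}$, $U$ ranging over the open subsets of $X$. It is Noetherian when $X$ is. The operations $+$ and $\omega^\beta$ are ordinary ordinal addition and exponentiation. *)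

(* Defs.v *)
From HB Require Import structures.
From mathcomp Require Import all_boot all_order finmap.
From mathcomp Require Import boolp classical_sets filter topology.

Set Implicit Arguments.
Unset Strict Implicit.
Unset Printing Implicit Defensive.

Local Open Scope classical_set_scope.

(* Ordinals are represented by well-founded trees: the tree [Osup f] stands for
   the ordinal sup_i (f i + 1).  Trees form a proper preordered class under
   [ole]; two trees denote the same ordinal iff they are [oeq].  The order
   is shown below to be total and well-founded. *)
Inductive Ord : Type := Osup (I : Type) (f : I -> Ord).

Declare Scope ord_scope.
Delimit Scope ord_scope with ord.
Bind Scope ord_scope with Ord.

Fixpoint ole (a b : Ord) : Prop :=
  let: @Osup A f := a in
  let: @Osup J g := b in
  forall i, exists j, ole (f i) (g j).

Definition olt (a b : Ord) : Prop :=
  let: @Osup J g := b in exists j, ole a (g j).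

Definition oeq (a b : Ord) : Prop := ole a b /\ ole b a.

Notation "a <= b" := (ole a b) : ord_scope.
Notation "a < b" := (olt a b) : ord_scope.

Definition oindex (a : Ord) : Type := let: @Osup A _ := a in A.
Definition obranch (a : Ord) : oindex a -> Ord :=
  let: @Osup _ f := a in f.

Definition ozero : Ord := Osup (of_void Ord).
Definition osucc (a : Ord) : Ord := Osup (fun _ : unit => a).
Definition oone : Ord := osucc ozero.
Definition omega : Ord := Osup (fun n : nat => iter n osucc ozero).

Definition omax (a b : Ord) : Ord :=
  let: @Osup A f := a in
  let: @Osup J g := b in
  Osup (fun k : A + J => match k with inl i => f i | inr j => g j end).

(* The plain supremum sup_i (f i), as opposed to [Osup f] = sup_i (f i + 1). *)
Definition olub (I : Type) (f : I -> Ord) : Ord :=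
  Osup (fun p : {i : I & oindex (f i)} => obranch (projT2 p)).

(* a + b = max (a, sup_(c < b) ((a + c) + 1)) *)
Fixpoint oadd (a b : Ord) : Ord :=
  let: @Osup J g := b in omax a (Osup (fun j => oadd a (g j))).

(* a * b = sup_(c < b) (a * c + a) *)
Fixpoint omul (a b : Ord) : Ord :=
  let: @Osup J g := b in olub (fun j => oadd (omul a (g j)) a).

(* omega ^ b = max (1, sup_(c < b) (omega ^ c * omega)) *)
Fixpoint opow_omega (b : Ord) : Ord :=
  let: @Osup J g := b in
  omax oone (olub (fun j => omul (opow_omega (g j)) omega)).

Notation "0" := ozero : ord_scope.
Notation "1" := oone : ord_scope.
Notation "a + b" := (oadd a b) : ord_scope.
Notation "a * b" := (omul a b) : ord_scope.
Notation "'omega^' b" := (opow_omega b)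
  (at level 30, right associativity, format "'omega^' b") : ord_scope.

Section OrdTheory.
Local Open Scope ord_scope.
Implicit Types a b c : Ord.

Lemma ole_refl a : a <= a.
Proof. by elim: a => A f IH i; exists i; apply: IH. Qed.

Lemma ole_trans b a c : a <= b -> b <= c -> a <= c.
Proof.
elim: a b c => A f IH [B g] [C h] fg gh i.
have [j ij] := fg i; have [k jk] := gh j.
by exists k; apply: IH ij jk.
Qed.

Lemma ole_lt_trans b a c : a <= b -> b < c -> a < c.
Proof. by case: c => C h ab [k bk]; exists k; apply: ole_trans ab bk. Qed.

Lemma olt_ole_trans b a c : a < b -> b <= c -> a < c.
Proof.
case: b c => B g [C h] [j aj] bc; have [k jk] := bc j.
by exists k; apply: ole_trans aj jk.
Qed.

Lemma oleP a b : a <= b <-> forall i : oindex a, obranch i < b.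
Proof. by case: a b => A f [B g]. Qed.

Lemma oltP a b : a < b <-> exists j : oindex b, a <= obranch j.
Proof. by case: b. Qed.

Lemma olt_obranch a (i : oindex a) : obranch i < a.
Proof. by apply/oltP; exists i; apply: ole_refl. Qed.

Lemma olt_osucc a : a < osucc a.
Proof. by exists tt; apply: ole_refl. Qed.

Lemma osucc_ole a b : osucc a <= b <-> a < b.
Proof. by rewrite oleP; split=> [/(_ tt)|]. Qed.

Lemma olt_wf : well_founded olt.
Proof.
move=> a; suff: forall b, b <= a -> Acc olt b by apply; apply: ole_refl.
elim: a => A f IH b ba; constructor => c cb.
by have [i ci] := olt_ole_trans cb ba; apply: IH ci.
Qed.

Lemma olt_ole a b : a < b -> a <= b.
Proof.
elim: a b => A f IH b fb; apply/oleP => i.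
move: fb => /oltP[j fj]; apply/oltP; exists j; apply: IH.
exact: olt_ole_trans (olt_obranch i) fj.
Qed.

Lemma ole_total a b : a <= b \/ b < a.
Proof.
elim: a b => A f IHf; elim=> B g IHg.
have [|nfg] := pselect (Osup f <= Osup g); first by left.
right; apply: contrapT => ngf; apply: nfg; apply/oleP => i; apply: contrapT.
move=> nfig; have [fig|gfi] := IHf i (Osup g); last first.
  by apply: ngf; exists i; apply: olt_ole gfi.
apply: ngf; exists i; apply/oleP => j /=.
have [fgj|//] := IHf i (g j).
by case: nfig; exists j.
Qed.

Lemma olub_ub A (f : A -> Ord) i : f i <= olub f.
Proof. by apply/oleP => k; exists (existT _ i k); apply: ole_refl. Qed.

Lemma olub_ole A (f : A -> Ord) b : olub f <= b <-> forall i, f i <= b.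
Proof.
split=> [fb i|fb]; first exact: ole_trans (olub_ub f i) fb.
by apply/oleP => -[i k] /=; apply: olt_ole_trans (olt_obranch k) (fb i).
Qed.

Lemma omax_ole a b c : omax a b <= c <-> a <= c /\ b <= c.
Proof.
case: a b => A f [B g]; rewrite !oleP; split=> [fg|[fc gc] [i|j]].
- by split=> [i|j]; [apply: (fg (inl i))|apply: (fg (inr j))].
- exact: fc.
- exact: gc.
Qed.

Lemma omax_ubl a b : a <= omax a b.
Proof. by have [+ _] := omax_ole a b (omax a b); case; first exact: ole_refl. Qed.

Lemma omax_ubr a b : b <= omax a b.
Proof. by have [+ _] := omax_ole a b (omax a b); case; first exact: ole_refl. Qed.

(* The clauses at zero, successors and suprema, [oadd0] to [opow_omega_olub],
   characterise the three operations up to [oeq]. *)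

Lemma oadd_ole a b c :
  a + b <= c <-> a <= c /\ forall j : oindex b, a + obranch j < c.
Proof. by case: b => B g; rewrite omax_ole (oleP (Osup _)); apply: iff_refl. Qed.

Lemma ole_addl a b : a <= a + b.
Proof. by have [] := proj1 (oadd_ole a b _) (ole_refl _). Qed.

Lemma olt_addl_obranch a b (j : oindex b) : a + obranch j < a + b.
Proof. by have [_] := proj1 (oadd_ole a b _) (ole_refl _); apply. Qed.

Lemma ole_addr a b c : b <= c -> a + b <= a + c.
Proof.
elim: b c => B g IH c bc; apply/oadd_ole; split=> [|j]; first exact: ole_addl.
have /oltP[k jk] := proj1 (oleP _ _) bc j.
exact: ole_lt_trans (IH j _ jk) (olt_addl_obranch a k).
Qed.

Lemma ole_addr_self a b : b <= a + b.
Proof.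
elim: b => B g IH; apply/oleP => j.
exact: ole_lt_trans (IH j) (olt_addl_obranch a (b := Osup g) j).
Qed.

Lemma oadd0 a : oeq (a + 0) a.
Proof.
split; last exact: ole_addl.
by apply/oadd_ole; split=> [|j]; [exact: ole_refl|case: j].
Qed.

Lemma oaddS a b : oeq (a + osucc b) (osucc (a + b)).
Proof.
split.
- apply/oadd_ole; split=> [|j]; last exact: olt_osucc.
  exact: ole_trans (ole_addl a b) (olt_ole (olt_osucc _)).
- by apply/osucc_ole; apply: (olt_addl_obranch a (b := osucc b) tt).
Qed.

Lemma oadd_olub a A (f : A -> Ord) (i0 : A) :
  oeq (a + olub f) (olub (fun i => a + f i)).
Proof.
split; last by apply/olub_ole => i; apply/ole_addr/olub_ub.
apply/oadd_ole; split=> [|[i k] /=].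
  exact: ole_trans (ole_addl a (f i0)) (olub_ub (fun i => a + f i) i0).
exact: olt_ole_trans (olt_addl_obranch a k) (olub_ub (fun i => a + f i) i).
Qed.

Lemma omul_ole a b c :
  a * b <= c <-> forall j : oindex b, a * obranch j + a <= c.
Proof. by case: b => B g; rewrite olub_ole; apply: iff_refl. Qed.

Lemma ole_mul_obranch a b (j : oindex b) : a * obranch j + a <= a * b.
Proof. exact: (proj1 (omul_ole a b _) (ole_refl _)). Qed.

Lemma ole_addl2 a b c : a <= b -> a + c <= b + c.
Proof.
move=> ab; elim: c => C h IH; apply/oadd_ole; split=> [|k].
  exact: ole_trans ab (ole_addl _ _).
exact: ole_lt_trans (IH k) (olt_addl_obranch b (b := Osup h) k).
Qed.

Lemma ole_mulr a b c : b <= c -> a * b <= a * c.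
Proof.
elim: b c => B g IH c bc; apply/omul_ole => j.
have /oltP[k jk] := proj1 (oleP _ _) bc j.
exact: ole_trans (ole_addl2 a (IH j _ jk)) (ole_mul_obranch a k).
Qed.

Lemma omul0 a : oeq (a * 0) 0.
Proof. by split; [apply/omul_ole|apply/oleP] => -[]. Qed.

Lemma omulS a b : oeq (a * osucc b) (a * b + a).
Proof.
split; first by apply/omul_ole => j; exact: ole_refl.
exact: (ole_mul_obranch a (b := osucc b) tt).
Qed.

Lemma omul_olub a A (f : A -> Ord) : oeq (a * olub f) (olub (fun i => a * f i)).
Proof.
split; last by apply/olub_ole => i; apply/ole_mulr/olub_ub.
apply/omul_ole => -[i k] /=.
exact: ole_trans (ole_mul_obranch a k) (olub_ub (fun i => a * f i) i).
Qed.

Lemma opow_omega_ole b c :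
  omega^ b <= c <-> 1 <= c /\ forall j : oindex b, omega^ (obranch j) * omega <= c.
Proof.
by case: b => B g; rewrite omax_ole olub_ole; apply: iff_refl.
Qed.

Lemma opow_omega_ge1 b : 1 <= omega^ b.
Proof. by have [] := proj1 (opow_omega_ole b _) (ole_refl _). Qed.

Lemma ole_pow_obranch b (j : oindex b) : omega^ (obranch j) * omega <= omega^ b.
Proof. by have [_] := proj1 (opow_omega_ole b _) (ole_refl _); apply. Qed.

Lemma ole_mull a b c : a <= b -> a * c <= b * c.
Proof.
move=> ab; elim: c => C h IH; apply/omul_ole => k /=.
apply: ole_trans (ole_mul_obranch b (b := Osup h) k).
exact: ole_trans (ole_addl2 a (IH k)) (ole_addr _ ab).
Qed.

Lemma ole_pow b c : b <= c -> omega^ b <= omega^ c.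
Proof.
elim: b c => B g IH c bc; apply/opow_omega_ole.
split=> [|j]; first exact: opow_omega_ge1.
have /oltP[k jk] := proj1 (oleP _ _) bc j.
exact: ole_trans (ole_mull omega (IH j _ jk)) (ole_pow_obranch k).
Qed.

Lemma opow_omega0 : oeq (omega^ 0) 1.
Proof.
split; last exact: opow_omega_ge1.
by apply/opow_omega_ole; split=> [|j]; [exact: ole_refl|case: j].
Qed.

Lemma opow_omegaS b : oeq (omega^ (osucc b)) (omega^ b * omega).
Proof.
split; last exact: (ole_pow_obranch (b := osucc b) tt).
apply/opow_omega_ole; split=> [|j]; last exact: ole_refl.
apply: ole_trans (opow_omega_ge1 b) _.
apply: ole_trans (ole_mul_obranch (omega^ b) (b := omega) 0%N) => /=.
exact: ole_addr_self.
Qed.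

Lemma opow_omega_olub A (f : A -> Ord) (i0 : A) :
  oeq (omega^ (olub f)) (olub (fun i => omega^ (f i))).
Proof.
split; last by apply/olub_ole => i; apply/ole_pow/olub_ub.
apply/opow_omega_ole; split=> [|[i k] /=].
  exact: ole_trans (opow_omega_ge1 (f i0)) (olub_ub (fun i => omega^ (f i)) i0).
exact: ole_trans (ole_pow_obranch k) (olub_ub (fun i => omega^ (f i)) i).
Qed.

End OrdTheory.

Section Rank.
Context (d : Order.disp_t) (P : porderType d).

Definition well_founded_poset : Prop := well_founded (fun x y : P => (x < y)%O).

Fixpoint rank_acc (x : P) (ax : Acc (fun x y : P => (x < y)%O) x) : Ord :=
  Osup (fun y : {y : P | (y < x)%O} => rank_acc (Acc_inv ax (proj2_sig y))).

Definition rank (wfP : well_founded_poset) (x : P) : Ord := rank_acc (wfP x).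

Definition ordinal_rank (wfP : well_founded_poset) : Ord := Osup (rank wfP).

Lemma rankE (wfP : well_founded_poset) (x : P) :
  rank wfP x = Osup (fun y : {y : P | (y < x)%O} => rank wfP (sval y)).
Proof.
rewrite {1}/rank; case: (wfP x) => ax /=; congr (Osup _).
by apply/funext => y; rewrite /rank; congr rank_acc; apply: Prop_irrelevance.
Qed.

End Rank.

(* [compact] of the library is phrased with filters; its equivalence with
   [cover_compact] is only available there for pointed spaces. *)
Definition noetherian (X : topologicalType) : Prop :=
  forall U : set X, open U -> cover_compact U.

Record H0 (X : topologicalType) :=
  ClosedSet { cset :> set X; cset_asbool : `[< closed cset >] }.

HB.instance Definition _ (X : topologicalType) := [isSub for @cset X].
HB.instance Definition _ (X : topologicalType) := [Choice of H0 X by <:].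
HB.instance Definition _ (X : topologicalType) :=
  [SubChoice_isSubPOrder of H0 X by <: with set_display].

Lemma H0_closed (X : topologicalType) (F : H0 X) : closed F.
Proof. exact/asboolP/(valP F). Qed.

Lemma H0_ltE (X : topologicalType) (F G : H0 X) :
  (F < G)%O = ((F : set X) `<` G) :> Prop.
Proof. by rewrite -properEset. Qed.

Lemma H0_leE (X : topologicalType) (F G : H0 X) :
  (F <= G)%O = ((F : set X) `<=` G) :> Prop.
Proof. by rewrite -subsetEset. Qed.

Definition H0_full (X : topologicalType) : H0 X :=
  ClosedSet (asboolT (@closedT X)).

Lemma H0_wf (X : topologicalType) :
  noetherian X -> well_founded_poset (H0 X).
Proof.
move=> nX F; apply: contrapT => nF.
pose T := {F : H0 X | ~ Acc (fun x y : H0 X => (x < y)%O) F}.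
have step (G : T) : {G' : T | (cset (sval G') `<` cset (sval G))}.
  apply: cid; apply: contrapT => noG; case: (svalP G).
  constructor => G' G'G; apply: contrapT => nG'; apply: noG.
  by exists (exist _ G' nG'); rewrite -H0_ltE.
have [f [_ fS]] := dependent_choice step (exist _ F nF : T).
pose g n := cset (sval (f n)).
have gW m n : (m <= n)%N -> g n `<=` g m.
  elim: n => [|n IH]; first by rewrite leqn0 => /eqP ->.
  rewrite leq_eqVlt => /predU1P[-> //|]; rewrite ltnS => mn.
  by apply: subset_trans (IH mn); have [] := fS n.
have go n : setT n -> open (~` g n).
  by move=> _; apply: closed_openC; apply: H0_closed.
have [D _ Dcov] := nX _ (bigcup_open go) _ _ _ go (fun x h => h).
pose N := \max_(n <- D) n.
have [_ []] := fS N => x gNx; apply: contrapT => ngx.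
have [|n /= Dn] := Dcov x; first by exists N.+1.
by apply; apply: gW gNx; exact: leq_bigmax_seq.
Qed.

(* ||X||, as the rank of X in H0 X; [ordinal_rank_H0] is the form |H0 X| - 1.
   [nX] only serves to make the rank function available. *)
Definition stature (X : topologicalType) (nX : noetherian X) : Ord :=
  rank (H0_wf nX) (H0_full X).

Lemma ordinal_rank_H0 (X : topologicalType) (nX : noetherian X) :
  oeq (ordinal_rank (H0_wf nX)) (osucc (stature nX)).
Proof.
split; last by apply/osucc_ole; exists (H0_full X); apply: ole_refl.
apply/oleP => F /=; exists tt; rewrite /stature.
have [->|FX] := eqVneq F (H0_full X); first exact: ole_refl.
apply: olt_ole; rewrite [X in olt _ X]rankE.
suff FT : (F < H0_full X)%O by exists (exist _ F FT); apply: ole_refl.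
by rewrite Order.POrderTheory.lt_neqAle FX H0_leE.
Qed.

(* A copy of [H0], to carry the lower Vietoris topology. *)
Definition H0V (X : topologicalType) : Type := H0 X.

HB.instance Definition _ (X : topologicalType) := Choice.on (H0V X).

Definition diamond (X : topologicalType) (U : set X) : set (H0V X) :=
  [set F : H0V X | F `&` U !=set0].

HB.instance Definition _ (X : topologicalType) :=
  isSubBaseTopological.Build (H0V X) (@open X) (@diamond X).

HB.instance Definition _ (X : topologicalType) :=
  isPointed.Build (H0V X) (H0_full X).

Lemma open_diamond (X : topologicalType) (U : set X) :
  open U -> open (diamond U).
Proof.
move=> oU; exists [set diamond U]; last by rewrite bigcup_set1.
by move=> _ ->; apply: finI_from1.
Qed.

Lemma H0V_noetherian (X : topologicalType) : noetherian X -> noetherian (H0V X).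
Proof.
move=> nX A _; rewrite -compact_cover compact_ultra => F FF FA.
pose D := [set U : set X | open U /\ ~ F (diamond U)].
pose V := \bigcup_(U in D) U.
have oD U : D U -> open U by case.
have [D' D'D VD'] := nX _ (bigcup_open oD) _ _ _ oD (fun x h => h).
have FV : F (~` diamond V).
  have : F (\bigcap_(U in [set` D']) ~` diamond U).
    apply: filter_bigI => U /D'D; rewrite inE => -[oU nFU].
    by have [] := in_ultra_setVsetC (diamond U) FF.
  apply: filterS => G DG [x [Gx Vx]].
  by have [U D'U Ux] := VD' x Vx; apply: (DG U D'U); exists x.
have [G [AG VG]] := filter_ex (filterI FA FV).
exists G; split=> // B; rewrite nbhsE => -[O [[I fI <-] [W IW WG]] OB].
apply: filterS OB _; have [E sE EW] := fI _ IW.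
suff : F W by apply: filterS => H WH; exists W.
move: WG; rewrite -EW => EG; apply: filter_bigI => U EU.
apply: contrapT => nFU; have [x [Gx Ux]] := EG U EU.
apply: VG; exists x; split=> //; exists U => //.
by split=> //; have := sE U EU; rewrite inE.
Qed.

(* Main.v *)
Require Import Defs.
From mathcomp Require Import all_boot all_order.
From mathcomp Require Import boolp classical_sets topology.
From mathcomp Require Import finmap cardinality.

(** For a closed set [C] of [X], the closed subsets of [X] contained in [C] form
    a closed set [box C] of the powerspace, and [box (H0_full X)] is the whole
    powerspace; so it suffices to show
    [1 + rk C <= rk (box C) <= omega^ (rk C)] for every [C], by well-founded
    induction on [C].

    The lower bound holds because [box] is strictly increasing, and already
    [box] of the empty set has a proper closed subset, the empty one
    ([rank_box_ge]).

    For the upper bound, let [F] be a closed set strictly inside [box C], and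
    choose [G] in [box C] outside [F].  A basic neighbourhood of [G] avoiding
    [F] is given by finitely many open sets [U] that all meet [G]; every member
    of [F] misses one of them.  Hence [F] is covered by the finitely many
    [box (C `\` U)], and [C `\` U] is strictly smaller than [C] since [G] is
    contained in [C] and meets [U] ([box_cover]).  By induction each of these
    boxes has rank less than [omega^ (rk C)].

    It remains to bound the rank of a finite union.  The rank is subadditive
    with respect to the Hessenberg (natural) sum of ordinals ([rank_subU]), and
    the ordinals below a power of [omega] are stable under that sum
    ([hsum_closed_opow_omega]); therefore [rk F < omega^ (rk C)]. *)

Set Implicit Arguments.
Unset Strict Implicit.
Unset Printing Implicit Defensive.

(** * Ordinal arithmetic and the Hessenberg sum *)

Section Ordinals.
Local Open Scope ord_scope.
Implicit Types a b c w x y : Ord.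

Lemma ozero_ole a : 0 <= a.
Proof. by apply/oleP => -[]. Qed.

Lemma olt_oadd2l a b c : b < c -> a + b < a + c.
Proof.
move=> /oltP[k bk].
exact: ole_lt_trans (ole_addr a bk) (olt_addl_obranch a k).
Qed.

Lemma olt_omax a b c : c < omax a b -> c < a \/ c < b.
Proof.
by case: a b => A f [B g] [[i|j] ck]; [left; exists i|right; exists j].
Qed.

Lemma olt_oadd a b c :
  c < a + b -> c < a \/ exists j : oindex b, c <= a + obranch j.
Proof.
by case: b => B g /olt_omax[ca|[j cj]]; [left|right; exists j].
Qed.

Lemma olt_olub A (f : A -> Ord) c : c < olub f -> exists i, c < f i.
Proof. by case=> -[i k] ck; exists i; apply/oltP; exists k. Qed.

(** Division with remainder by [w]; the quotient is only bounded by [n], but the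
    inequality makes this enough for upper bounds. *)
Lemma olt_omul_nat w n c : 0 < w -> c < w * iter n.+1 osucc 0 ->
  exists2 x, x < w & c <= w * iter n osucc 0 + x.
Proof.
move=> w0 /= /olt_olub[_ /olt_oadd[cwn|[j cj]]]; last first.
  by exists (obranch j) => //; apply: olt_obranch.
by exists 0 => //; apply: ole_trans (olt_ole cwn) (ole_addl _ _).
Qed.

(** Nonzero ordinals below a power of [omega] are reached by finite multiples of
    smaller powers: the leading term of the Cantor normal form is all that is
    needed to bound sums. *)
Lemma olt_opow_omega b c : c < omega^ b ->
  c <= 0 \/ exists j : oindex b, exists n : nat,
    c < omega^ (obranch j) * iter n.+1 osucc 0.
Proof.
case: b => B g /olt_omax[[_ c0]|]; first by left.
move=> /olt_olub[j /olt_olub[n cn]]; right; exists j, n.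
apply: olt_ole_trans cn _.
exact: (ole_mul_obranch _ (b := osucc _) tt).
Qed.

Lemma opow_omega_gt0 b : 0 < omega^ b.
Proof. exact/osucc_ole/opow_omega_ge1. Qed.

Lemma olt_opow_omega_mono b c : b < c -> omega^ b < omega^ c.
Proof.
move=> /oltP[j bj]; apply: ole_lt_trans (ole_pow bj) _.
apply: olt_ole_trans (ole_pow_obranch j).
set w := omega^ _; apply: olt_ole_trans (ole_mul_obranch w (b := omega) 1%N).
have w_le : w <= w * iter 1 osucc 0.
  exact: ole_trans (ole_addr_self (w * 0) w) (proj2 (omulS w 0)).
apply: ole_lt_trans w_le _; apply: ole_lt_trans (ole_addl _ 0) _.
exact: (olt_oadd2l _ (opow_omega_gt0 _)).
Qed.

(** The Hessenberg (natural) sum, by Conway's recursion: the least operation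
    strictly increasing in both arguments. *)
Fixpoint hsum (a : Ord) : Ord -> Ord :=
  let: @Osup A f := a in
  fix hsum_a (b : Ord) : Ord :=
    let: @Osup B g := b in
    Osup (fun k : A + B =>
      match k with inl i => hsum (f i) b | inr j => hsum_a (g j) end).

Lemma hsum_ole_obranch a b c : hsum a b <= c <->
  (forall i : oindex a, hsum (obranch i) b < c) /\
  (forall j : oindex b, hsum a (obranch j) < c).
Proof.
case: a b => A f [B g]; rewrite oleP; split=> [h|[hl hr] [i|j]].
- by split=> [i|j]; [apply: (h (inl i))|apply: (h (inr j))].
- exact: hl.
- exact: hr.
Qed.

Lemma hsum_obranchl a b (i : oindex a) : hsum (obranch i) b < hsum a b.
Proof. by have [] := proj1 (hsum_ole_obranch a b _) (ole_refl _). Qed.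

Lemma hsum_obranchr a b (j : oindex b) : hsum a (obranch j) < hsum a b.
Proof. by have [] := proj1 (hsum_ole_obranch a b _) (ole_refl _). Qed.

Lemma ole_hsum a b c d : a <= c -> b <= d -> hsum a b <= hsum c d.
Proof.
elim: a b c d => A f IHa; elim=> B g IHb c d ac bd.
apply/hsum_ole_obranch; split=> [i|j].
- have /oltP[k ik] := proj1 (oleP _ _) ac i.
  exact: ole_lt_trans (IHa i _ _ _ ik bd) (hsum_obranchl d k).
- have /oltP[k jk] := proj1 (oleP _ _) bd j.
  exact: ole_lt_trans (IHb j _ _ ac jk) (hsum_obranchr c k).
Qed.

Lemma olt_hsuml a b c d : a < c -> b <= d -> hsum a b < hsum c d.
Proof.
move=> /oltP[i ai] bd.
exact: ole_lt_trans (ole_hsum ai bd) (hsum_obranchl d i).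
Qed.

Lemma olt_hsumr a b c d : a <= c -> b < d -> hsum a b < hsum c d.
Proof.
move=> ac /oltP[j bj].
exact: ole_lt_trans (ole_hsum ac bj) (hsum_obranchr c j).
Qed.

Lemma hsum0l_ole b : hsum 0 b <= b.
Proof.
elim: b => B g IH; apply/hsum_ole_obranch; split=> [[]|j].
exact: ole_lt_trans (IH j) (olt_obranch (a := Osup g) j).
Qed.

Lemma hsum0r_ole a : hsum a 0 <= a.
Proof.
elim: a => A f IH; apply/hsum_ole_obranch; split=> [i|[]].
exact: ole_lt_trans (IH i) (olt_obranch (a := Osup f) i).
Qed.

Definition hsum_closed w := forall x y, x < w -> y < w -> hsum x y < w.

(** The natural sum adds finite multiples of [w] coefficientwise.  An ordinal
    below [w * n + x] either keeps the multiple and lowers the remainder, or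
    drops to a multiple [w * n'] with [n' < n], up to a remainder [x' < w]; in
    the second case the sum of the remainders may grow, but stays below [w], so
    it does not make up for the lost copy of [w]. *)
Lemma hsum_omul_nat w n m x y : hsum_closed w -> x < w -> y < w ->
  hsum (w * iter n osucc 0 + x) (w * iter m osucc 0 + y) <=
  w * iter (n + m) osucc 0 + hsum x y.
Proof.
move=> wcl; have [k nmk] := ubnP (n + m)%N.
elim: k n m nmk x y => // k IHk n m; rewrite ltnS => nmk.
(* The case where one copy of [w] is lost, on either side. *)
have step n' m' x' y' z : (n' + m').+1 = (n + m)%N -> x' < w -> y' < w ->
    hsum (w * iter n' osucc 0 + x') (w * iter m' osucc 0 + y') <
    w * iter (n + m) osucc 0 + z.
  move=> nm xw yw; have nmk' : (n' + m' < k)%N by rewrite nm.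
  apply: ole_lt_trans (IHk _ _ nmk' _ _ xw yw) _.
  apply: olt_ole_trans (ole_addl _ _); rewrite -nm.
  apply: olt_ole_trans (olt_oadd2l _ (wcl _ _ xw yw)) _.
  exact: (proj2 (omulS _ _)).
elim=> A f IHx; elim=> B g IHy xw yw.
have w0 : 0 < w by exact: ole_lt_trans (ozero_ole _) xw.
have fw i : f i < w.
  by apply: olt_ole_trans (olt_ole xw); apply: (olt_obranch (a := Osup f)).
have gw j : g j < w.
  by apply: olt_ole_trans (olt_ole yw); apply: (olt_obranch (a := Osup g)).
apply/hsum_ole_obranch; split=> [i|j].
- have /olt_oadd[|[i' ii']] := olt_obranch i.
  + case: n {IHx IHy i} nmk step (obranch i) => [|n] _ step u.
      by move=> /olt_olub[[]].
    move=> /(olt_omul_nat w0)[x' xw' ux].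
    by apply: ole_lt_trans (ole_hsum ux (ole_refl _)) _; apply: step.
  + apply: ole_lt_trans (ole_hsum ii' (ole_refl _)) _.
    apply: ole_lt_trans (IHx i' _ (fw i') yw) _.
    by apply: olt_oadd2l; apply: (hsum_obranchl (a := Osup f)).
- have /olt_oadd[|[j' jj']] := olt_obranch j.
  + case: m {IHx IHy j} nmk step (obranch j) => [|m] _ step u.
      by move=> /olt_olub[[]].
    move=> /(olt_omul_nat w0)[y' yw' uy].
    apply: ole_lt_trans (ole_hsum (ole_refl _) uy) _; apply: step => //.
    by rewrite addnS.
  + apply: ole_lt_trans (ole_hsum (ole_refl _) jj') _.
    apply: ole_lt_trans (IHy j' xw (gw j')) _.
    by apply: olt_oadd2l; apply: (hsum_obranchr _ (b := Osup g)).
Qed.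

(** Two ordinals below [omega^ c] lie below finite multiples of one common
    [omega^ k] with [k < c]; by induction [omega^ k] is closed under [hsum], so
    their natural sum is below a finite multiple of [omega^ k] as well. *)
Lemma hsum_closed_opow_omega c : hsum_closed (omega^ c).
Proof.
elim: c => C h IH a b ac bc.
have [a0|[i [n ai]]] := olt_opow_omega ac.
  apply: ole_lt_trans bc; apply: ole_trans (hsum0l_ole b).
  exact: ole_hsum a0 (ole_refl _).
have [b0|[j [m bj]]] := olt_opow_omega bc.
  apply: ole_lt_trans ac; apply: ole_trans (hsum0r_ole a).
  exact: ole_hsum (ole_refl _) b0.
have [k [ik jk]] : exists k, h i <= h k /\ h j <= h k.
  have [ij|/olt_ole ji] := ole_total (h i) (h j).
    by exists j; split=> //; apply: ole_refl.
  by exists i; split=> //; apply: ole_refl.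
have wk_gt0 := opow_omega_gt0 (h k).
have /(olt_omul_nat wk_gt0)[x xk ax] :=
  olt_ole_trans ai (ole_mull _ (ole_pow ik)).
have /(olt_omul_nat wk_gt0)[y yk by_] :=
  olt_ole_trans bj (ole_mull _ (ole_pow jk)).
apply: ole_lt_trans (ole_hsum ax by_) _.
apply: ole_lt_trans (hsum_omul_nat _ _ (IH k) xk yk) _.
apply: olt_ole_trans (olt_oadd2l _ (IH k x y xk yk)) _.
apply: ole_trans (ole_mul_obranch _ (b := omega) (n + m)%N) _.
exact: (ole_pow_obranch (b := Osup h) k).
Qed.

End Ordinals.

(** * Ranks in a well-founded poset *)

Section Rank.
Local Open Scope ord_scope.
Context (d : Order.disp_t) (P : porderType d) (wfP : well_founded_poset P).
Implicit Types x y : P.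

Lemma rank_ole x c : rank wfP x <= c <-> forall y, (y < x)%O -> rank wfP y < c.
Proof.
rewrite [X in X <= c]rankE oleP; split=> [h y yx|h [y yx]]; last exact: h.
exact: (h (exist _ y yx)).
Qed.

Lemma rank_lt x y : (x < y)%O -> rank wfP x < rank wfP y.
Proof. by move=> xy; have /rank_ole := ole_refl (rank wfP y); apply. Qed.

Lemma rank_le x y : (x <= y)%O -> rank wfP x <= rank wfP y.
Proof.
rewrite Order.POrderTheory.le_eqVlt => /predU1P[->|/rank_lt/olt_ole //].
exact: ole_refl.
Qed.

End Rank.

Local Open Scope classical_set_scope.

(** * Ranks of finite unions of closed sets *)

Section ClosedSets.
Context (X : topologicalType).

Definition H0_meet (F G : H0 X) : H0 X :=
  ClosedSet (asboolT (closedI (@H0_closed _ F) (@H0_closed _ G))).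

Definition H0_empty : H0 X := ClosedSet (asboolT (@closed0 X)).

Definition H0_closure (A : set X) : H0 X :=
  ClosedSet (asboolT (@closed_closure _ A)).

Context (nX : noetherian X).
Local Notation rk := (rank (H0_wf nX)).

(** Going down strictly from [F] to [G], the traces of [G] on [A] and [B] still
    cover [G], and a point of [F] outside [G] makes at least one of them
    strictly smaller than [A] or [B]: the natural sum of the ranks drops. *)
Lemma rank_subU (F A B : H0 X) :
  (F : set X) `<=` A `|` B -> (rk F <= hsum (rk A) (rk B))%ord.
Proof.
elim/(well_founded_ind (H0_wf nX)): F A B => F IH A B FAB.
apply/rank_ole => G GF; have := GF; rewrite H0_ltE => -[GF' FG].
apply: ole_lt_trans (IH G GF (H0_meet G A) (H0_meet G B) _) _.
  by move=> x Gx; have [] := FAB x (GF' x Gx); [left|right].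
have meet_le (C : H0 X) : (H0_meet G C <= C)%O by rewrite H0_leE => x [].
have /nonsubset[x [Fx nGx]] := FG.
have meet_lt (C : H0 X) : (C : set X) x -> (H0_meet G C < C)%O.
  by move=> Cx; rewrite H0_ltE; split=> [y []//|/(_ x Cx)[]].
have [/meet_lt|/meet_lt] := FAB x Fx => /(rank_lt (H0_wf nX)) lt.
- by apply: olt_hsuml lt _; apply: rank_le.
- by apply: olt_hsumr _ lt; apply: rank_le.
Qed.

Lemma rank_lt_opow_omega_cover (F : H0 X) (s : seq (H0 X)) c :
  (forall G, G \in s -> rk G < omega^ c)%ord ->
  (F : set X) `<=` \bigcup_(G in [set` s]) G -> (rk F < omega^ c)%ord.
Proof.
elim: s F => [|G s IH] F rks Fs.
  apply: ole_lt_trans (opow_omega_gt0 c); apply/rank_ole => G.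
  by rewrite H0_ltE => -[_ nFG]; exfalso; apply: nFG => x /Fs[].
pose K : set X := \bigcup_(G in [set` s]) G.
have clK : closed K.
  by apply: closed_bigcup => [|H _]; [exact: finite_seq|exact: H0_closed].
apply: ole_lt_trans (rank_subU (B := ClosedSet (asboolT clK)) (A := G) _) _.
  move=> x /Fs[H /=]; rewrite inE => /predU1P[->|Hs Hx]; first by left.
  by right; exists H.
apply: hsum_closed_opow_omega; first by apply: rks; rewrite mem_head.
by apply: IH => // H Hs; apply: rks; rewrite in_cons Hs orbT.
Qed.

End ClosedSets.

(** * Boxes in the lifted Hoare powerspace *)

Section Powerspace.
Context (X : topologicalType).

Lemma closed_below (C : H0 X) : closed [set F : H0V X | (F : set X) `<=` C].
Proof.
have -> : [set F : H0V X | (F : set X) `<=` C] = ~` diamond (~` C).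
  apply/seteqP; split=> F /= FC; first by case=> x [/FC].
  by move=> x Fx; apply: contrapT => nCx; apply: FC; exists x.
exact/open_closedC/open_diamond/closed_openC/H0_closed.
Qed.

Definition box (C : H0 X) : H0 (H0V X) := ClosedSet (asboolT (@closed_below C)).

Lemma box_lt (C D : H0 X) : (C < D)%O -> (box C < box D)%O.
Proof.
rewrite !H0_ltE => -[CD nDC]; split.
  by move=> F FC; apply: subset_trans CD.
by move=> /(_ D (fun x h => h)).
Qed.

Lemma box_full : box (H0_full X) = H0_full (H0V X).
Proof. by apply: val_inj; apply/seteqP; split. Qed.

(** Membership in an open set of the powerspace is guaranteed by meeting
    finitely many open sets of [X]: this is the base generated by the subbase of
    the sets [diamond U]. *)
Lemma open_H0VP (O : set (H0V X)) (G : H0V X) : open O -> O G ->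
  exists E : seq (set X),
    [/\ (forall U, U \in E -> open U), (forall U, U \in E -> diamond U G) &
        forall H, (forall U, U \in E -> diamond U H) -> O H].
Proof.
move=> [I fI <-] [W IW WG]; have [E sE EW] := fI _ IW.
exists (enum_fset E); split=> [U /sE/set_mem //|U UE|H HE].
- by move: WG; rewrite -EW; apply.
- suff WH : W H by exists W.
  by rewrite -EW => U UE; apply: HE.
Qed.

(** The boxes are those of [C `\` U], for [U] in a finite family that
    describes a neighbourhood, disjoint from [F], of a point [G] of [box C]. *)
Lemma box_cover (C : H0 X) (F : H0 (H0V X)) : (F < box C)%O ->
  exists2 s : seq (H0 X), (forall D, D \in s -> (D < C)%O) &
    (F : set (H0V X)) `<=` \bigcup_(D in [set` s]) box D.
Proof.
rewrite H0_ltE => -[FC nCF].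
have /nonsubset[G [GC nFG]] := nCF.
have [E [oE EG EF]] := open_H0VP (closed_openC (@H0_closed _ F)) nFG.
have E_closed U : U \in E -> closure (~` U) = ~` U.
  by move=> /oE/open_closedC/closure_id <-.
(* [~` U] is replaced by its closure, which is closed also for [U] outside [E]. *)
exists [seq H0_meet C (H0_closure (~` U)) | U <- E].
  move=> D /mapP[U UE ->]; rewrite H0_ltE; split=> [x []//|nCU].
  have [x [Gx Ux]] := EG U UE.
  by have [_] := nCU x (GC x Gx); rewrite /= E_closed.
move=> H FH.
have [U [UE nHU]] : exists U, U \in E /\ ~ diamond U H.
  apply: contrapT => nU; apply: (EF H _ FH) => U UE.
  by apply: contrapT => nUH; apply: nU; exists U.
exists (H0_meet C (H0_closure (~` U))); first exact/mapP/(ex_intro2 _ _ U).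
move=> x Hx; split; first exact: (FC H FH).
by rewrite /= E_closed // => Ux; apply: nHU; exists x.
Qed.

Context (nX : noetherian X).
Local Notation rkX := (rank (H0_wf nX)).
Local Notation rkV := (rank (H0_wf (H0V_noetherian nX))).

(** The summand [1] comes from the empty closed set: it lies in every box, so no
    box is the least closed set of the powerspace. *)
Lemma rank_box_ge (C : H0 X) : (1 + rkX C <= rkV (box C))%ord.
Proof.
elim/(well_founded_ind (H0_wf nX)): C => C IH.
rewrite rankE; apply/oadd_ole; split=> [|[D DC]].
  apply/osucc_ole; apply: ole_lt_trans (ozero_ole (rkV (H0_empty _))) _.
  apply: rank_lt; rewrite H0_ltE; split=> [?//|].
  by move=> /(_ (H0_empty X)); apply.
exact: ole_lt_trans (IH D DC) (rank_lt _ (box_lt DC)).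
Qed.

Lemma rank_box_le (C : H0 X) : (rkV (box C) <= omega^ (rkX C))%ord.
Proof.
elim/(well_founded_ind (H0_wf nX)): C => C IH.
apply/rank_ole => F /box_cover[s sC Fs].
apply: (rank_lt_opow_omega_cover (s := [seq box D | D <- s])).
  move=> _ /mapP[D /sC DC ->]; apply: ole_lt_trans (IH D DC) _.
  exact/olt_opow_omega_mono/rank_lt.
by move=> G /Fs[D /= Ds DG]; exists (box D) => //=; apply: map_f.
Qed.

End Powerspace.

Theorem proposition11p2 (X : topologicalType) (nX : noetherian X) :
  (1 + stature nX <= stature (H0V_noetherian nX))%ord /\
  (stature (H0V_noetherian nX) <= omega^ (stature nX))%ord.
Proof.
rewrite /stature -box_full; split; [exact: rank_box_ge|exact: rank_box_le].
Qed.
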